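(* Let $(\bigcup_{i=1}^n(X_i,\precsim_i),\mathcal{P}=\bigcup_{i=1}^{n-1}\mathcal{P}_{i\,i+1})$ be a distributed system of $n$ processes with line communication such that for every $i\in\{1,\dots,n-1\}$ the pair $(u_i,v_i)$, with $u_i:X_i\to(0,1)$, $v_i:X_{i+1}\to(0,1)$, represents the biorder $\overline{\mathcal{P}}_{i\,i+1}$ and moreover $u_i$ represents the total order $\precsim_i$ and $v_i$ represents $\precsim_{i+1}$. Define functions $w_j:X_j\to\mathbb{R}$ by $w_1=u_1+\sum_{k=1}^{n-2}\underline{op}^k(u_{k+1})$, $w_j=\sum_{k=1}^{j-2}\overline{op}^{\,j-1-k}(v_k)+v_{j-1}+u_j+\sum_{k=1}^{n-j-1}\underline{op}^k(u_{k+j})$ for $2\le j\le n-1$, $w_n=v_{n-1}+\sum_{k=1}^{n-2}\overline{op}^{\,k}(v_{n-1-k})$. Then $(w_1,\dots,w_n)$ is a weak representation of the distributed system.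
   Context: A communication from $A$ to $B$ is a finite relation $\mathcal{P}\subseteq A\times B$ such that each element of $A$ is related to at most one element of $B$ and vice versa. A distributed system consists of pairwise disjoint totally ordered sets (processes) $(X_i,\precsim_i)$ and communications $\mathcal{P}_{ij}$ from $X_i$ to $X_j$; line communication means $\mathcal{P}_{ij}=\emptyset$ unless $j=i+1$. $\overline{\mathcal{P}}_{i\,i+1}$: $x\overline{\mathcal{P}}_{i\,i+1}y$ iff $x\precsim_i x'\mathcal{P}_{i\,i+1}y'\precsim_{i+1}y$ for some $x',y'$. A pair $(u,v)$ represents a biorder $\mathcal{R}$ if $a\mathcal{R}b\iff u(a)<v(b)$; a function represents a total order $\precsim$ if $x\precsim y\iff f(x)\le f(y)$. Operators (with $\inf\emptyset=1$, $\sup\emptyset=0$): for an increasing $f:X_{i+1}\to[0,1]$, $\underline{op}(f):X_i\to[0,1]$, $\underline{op}(f)(x)=\inf\{f(y):y\in X_{i+1},\ x\overline{\mathcal{P}}_{i\,i+1}y\}$; for an increasing $g:X_i\to[0,1]$, $\overline{op}(g):X_{i+1}\to[0,1]$, $\overline{op}(g)(x)=\sup\{g(y):y\in X_i,\ y\overline{\mathcal{P}}_{i\,i+1}x\}$. Iterates: $\underline{op}^k(f)=\underline{op}(\underline{op}^{k-1}(f))$ (so $\underline{op}^k(u_i)$ is defined on $X_{i-k}$) and similarly $\overline{op}^k(g)$ on $X_{i+k}$. A weak representation is a family $\{w_i\}$, $w_i:X_i\to\mathbb{R}$, with each $w_i$ representing $\precsim_i$ and $x\overline{\mathcal{P}}_{ij}y\Rightarrow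 w_i(x)<w_j(y)$ for all $i\ne j$ (where $\overline{\mathcal{P}}_{ij}$ is empty for $j\neq i+1$). Standing assumptions: causal ordering of messages holds and the causal precedence is a strict partial order. *)

(* Defs.v *)
From HB Require Import structures.
From Stdlib Require Import Relation_Operators RelationClasses.
From mathcomp Require Import all_boot all_order all_algebra.
From mathcomp Require Import all_classical all_reals.
Set Implicit Arguments.
Unset Strict Implicit.
Unset Printing Implicit Defensive.
Import Order.TTheory GRing.Theory Num.Theory.
Local Open Scope classical_set_scope.
Local Open Scope ring_scope.

Definition total_order_on (T : Type) (A : set T) (r : T -> T -> Prop) : Prop :=
  [/\ forall x y, r x y -> A x /\ A y,
      forall x, A x -> r x x,
      forall x y, r x y -> r y x -> x = y,
      forall x y z, r x y -> r y z -> r x z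
    & total_on A r].

Definition communication (T : Type) (A B : set T) (P : T -> T -> Prop) : Prop :=
  [/\ forall a b, P a b -> A a /\ B b,
      finite_set [set p : T * T | P p.1 p.2],
      forall a b b', P a b -> P a b' -> b = b'
    & forall a a' b, P a b -> P a' b -> a = a'].

(* Processes are indexed by 1, ..., n, and are disjoint subsets of one type E
   of events; the fields are unconstrained at indices outside this range. *)
Record dsystem (n : nat) (E : Type) := DSystem {
  proc : nat -> set E;
  ple : nat -> E -> E -> Prop;
  comm : nat -> nat -> E -> E -> Prop;
  proc_disjoint : trivIset [set i | (1 <= i <= n)%N] proc;
  ple_total_order :
    forall i, (1 <= i <= n)%N -> total_order_on (proc i) (ple i);
  comm_communication :
    forall i j, (1 <= i <= n)%N -> (1 <= j <= n)%N ->
      communication (proc i) (proc j) (comm i j) }.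

Definition line_communication n E (S : dsystem n E) : Prop :=
  forall i j, (1 <= i <= n)%N -> (1 <= j <= n)%N -> j <> i.+1 ->
    forall x y, ~ comm S i j x y.

Definition plt n E (S : dsystem n E) (i : nat) (x y : E) : Prop :=
  ple S i x y /\ ~ ple S i y x.

Definition causal_step n E (S : dsystem n E) (x y : E) : Prop :=
  (exists2 i, (1 <= i <= n)%N & plt S i x y) \/
  (exists i j, [/\ (1 <= i <= n)%N, (1 <= j <= n)%N & comm S i j x y]).

Definition causal_precedence n E (S : dsystem n E) : E -> E -> Prop :=
  clos_trans E (causal_step S).

(* Two messages with the same destination process are received in the order
   in which they were (causally) sent, possibly by different senders. *)
Definition causal_ordering n E (S : dsystem n E) : Prop :=
  forall i k j x y x' y',
    (1 <= i <= n)%N -> (1 <= k <= n)%N -> (1 <= j <= n)%N ->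
    comm S i j x y -> comm S k j x' y' ->
    causal_precedence S x x' -> plt S j y y'.

Definition pbar n E (S : dsystem n E) (i j : nat) (x y : E) : Prop :=
  exists x' y', [/\ ple S i x x', comm S i j x' y' & ple S j y' y].

Definition represents_order (R : realType) (T : Type) (A : set T)
    (r : T -> T -> Prop) (f : T -> R) : Prop :=
  forall x y, A x -> A y -> (r x y <-> f x <= f y).

Definition represents_biorder (R : realType) (T : Type) (A B : set T)
    (r : T -> T -> Prop) (u v : T -> R) : Prop :=
  forall a b, A a -> B b -> (r a b <-> u a < v b).

(* Infimum and supremum inside [0, 1]; the library sets inf set0 = 0. *)
Definition inf01 (R : realType) (A : set R) : R :=
  if `[< A = set0 >] then 1 else inf A.

Definition sup01 (R : realType) (A : set R) : R :=
  if `[< A = set0 >] then 0 else sup A.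

(* Functions on a process are total functions on E of which only the values on
   that process matter: [lop S i] takes a function on X_(i+1) to one on X_i,
   and [uop S i] takes a function on X_i to one on X_(i+1). *)
Definition lop n E (S : dsystem n E) (R : realType) (i : nat) (f : E -> R) :
    E -> R :=
  fun x => inf01 [set f y | y in [set y | proc S i.+1 y /\ pbar S i i.+1 x y]].

Definition uop n E (S : dsystem n E) (R : realType) (i : nat) (g : E -> R) :
    E -> R :=
  fun x => sup01 [set g y | y in [set y | proc S i y /\ pbar S i i.+1 y x]].

(* For f on X_m and k < m, [lop_iter S m k f] is the k-th iterate, a function
   on X_(m-k). *)
Fixpoint lop_iter n E (S : dsystem n E) (R : realType) (m k : nat)
    (f : E -> R) : E -> R :=
  if k is k'.+1 then lop S (m - k'.+1)%N (lop_iter S m k' f) else f.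

(* For g on X_m, [uop_iter S m k g] is the k-th iterate, a function on
   X_(m+k). *)
Fixpoint uop_iter n E (S : dsystem n E) (R : realType) (m k : nat)
    (g : E -> R) : E -> R :=
  if k is k'.+1 then uop S (m + k')%N (uop_iter S m k' g) else g.

Definition weak_representation n E (S : dsystem n E) (R : realType)
    (w : nat -> E -> R) : Prop :=
  (forall i, (1 <= i <= n)%N ->
     represents_order (proc S i) (ple S i) (w i)) /\
  (forall i j, (1 <= i <= n)%N -> (1 <= j <= n)%N -> i <> j ->
     forall x y, proc S i x -> proc S j y -> pbar S i j x y -> w i x < w j y).

(* Main.v *)
(** Each [w j] is the sum over [1 <= m < n] of one term per communication [m],
    [transport j m]: the function [v m] pushed up from [X_(m+1)] to [X_j] when
    [m < j], and [u m] pulled down from [X_m] to [X_j] otherwise. Every term is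
    increasing on [X_j], and one of them is some [u] or [v], which represents
    the order. Along a communication from [X_j] to [X_(j+1)] no term decreases,
    as a supremum or infimum is compared with one of its members, and term
    [m = j] goes strictly up from [u j] to [v j]. *)

Require Import Defs.
From HB Require Import structures.
From Stdlib Require Import Relation_Operators RelationClasses.
From mathcomp Require Import all_boot all_order all_algebra.
From mathcomp Require Import all_classical all_reals.
From mathcomp Require Import zify.
Set Implicit Arguments.
Unset Strict Implicit.
Unset Printing Implicit Defensive.
Import Order.TTheory GRing.Theory Num.Theory.
Local Open Scope classical_set_scope.
Local Open Scope ring_scope.

Section UnitIntervalBounds.
Variable R : realType.
Implicit Types (A B : set R) (a : R).

Local Notation in01 A := (forall a, A a -> 0 <= a <= 1).

Lemma in01_has_lbound A : in01 A -> has_lbound A.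
Proof. by move=> A01; exists 0 => a /A01/andP[]. Qed.

Lemma in01_has_ubound A : in01 A -> has_ubound A.
Proof. by move=> A01; exists 1 => a /A01/andP[]. Qed.

Lemma inf01_le A a : in01 A -> A a -> inf01 A <= a.
Proof.
move=> A01 Aa; rewrite /inf01; case: asboolP => [A0|_].
  by move: Aa; rewrite A0.
exact: ge_inf (in01_has_lbound A01) _ Aa.
Qed.

Lemma sup01_ge A a : in01 A -> A a -> a <= sup01 A.
Proof.
move=> A01 Aa; rewrite /sup01; case: asboolP => [A0|_].
  by move: Aa; rewrite A0.
exact: ub_le_sup (in01_has_ubound A01) _ Aa.
Qed.

Lemma inf01_in01 A : in01 A -> 0 <= inf01 A <= 1.
Proof.
move=> A01; have [A0|/eqP/set0P[a Aa]] := pselect (A = set0).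
  by rewrite /inf01 A0 asboolT// ler01 lexx.
have /andP[_ a1] := A01 _ Aa.
rewrite (le_trans (inf01_le A01 Aa) a1) andbT /inf01.
case: asboolP => // _; apply: lb_le_inf; first by exists a.
by move=> b /A01/andP[].
Qed.

Lemma sup01_in01 A : in01 A -> 0 <= sup01 A <= 1.
Proof.
move=> A01; have [A0|/eqP/set0P[a Aa]] := pselect (A = set0).
  by rewrite /sup01 A0 asboolT// ler01 lexx.
have /andP[a0 _] := A01 _ Aa.
rewrite (le_trans a0 (sup01_ge A01 Aa)) /= /sup01.
case: asboolP => // _; apply: ge_sup; first by exists a.
by move=> b /A01/andP[].
Qed.

(** The value 1 of the empty infimum covers the case of empty [B]; the library value 0 would break
    it. *)
Lemma le_inf01 A B : in01 A -> B `<=` A -> inf01 A <= inf01 B.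
Proof.
move=> A01 BA; have [B0|/eqP/set0P B0] := pselect (B = set0).
  by rewrite /(inf01 B) B0 asboolT//; have /andP[] := inf01_in01 A01.
rewrite /(inf01 B); case: asboolP => [B0'|_]; first by case: B0 => b; rewrite B0'.
by apply: lb_le_inf => // b /BA; exact: inf01_le.
Qed.

(** Dually, the empty supremum 0 lies below every supremum taken in the unit interval. *)
Lemma le_sup01 A B : in01 B -> A `<=` B -> sup01 A <= sup01 B.
Proof.
move=> B01 AB; have [A0|/eqP/set0P A0] := pselect (A = set0).
  by rewrite /(sup01 A) A0 asboolT//; have /andP[] := sup01_in01 B01.
rewrite /(sup01 A); case: asboolP => [A0'|_]; first by case: A0 => a; rewrite A0'.
by apply: ge_sup => // a /AB; exact: sup01_ge.
Qed.

End UnitIntervalBounds.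

Section TransportOperators.
Variables (R : realType) (n : nat) (E : Type) (S : dsystem n E).
Implicit Types (f g : E -> R) (x y : E) (i m k : nat).

Local Notation in01_on i f := (forall x, proc S i x -> 0 <= f x <= 1).

Lemma pbar_trans_l i j x x' y : (1 <= i <= n)%N ->
  ple S i x x' -> pbar S i j x' y -> pbar S i j x y.
Proof.
move=> iP xx' [a [b [x'a ab b_y]]]; exists a, b; split => //.
by have [_ _ _ tr _] := ple_total_order S iP; exact: tr x'a.
Qed.

Lemma pbar_trans_r i j x y y' : (1 <= j <= n)%N ->
  pbar S i j x y -> ple S j y y' -> pbar S i j x y'.
Proof.
move=> jP [a [b [xa ab b_y]]] yy'; exists a, b; split => //.
by have [_ _ _ tr _] := ple_total_order S jP; exact: tr yy'.
Qed.

Lemma lop_in01 i f x : in01_on i.+1 f -> 0 <= lop S i f x <= 1.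
Proof. by move=> f01; apply: inf01_in01 => _ [y [Xy _] <-]; exact: f01. Qed.

Lemma uop_in01 i g x : in01_on i g -> 0 <= uop S i g x <= 1.
Proof. by move=> g01; apply: sup01_in01 => _ [y [Xy _] <-]; exact: g01. Qed.

Lemma lop_le i f x y : in01_on i.+1 f -> proc S i.+1 y ->
  pbar S i i.+1 x y -> lop S i f x <= f y.
Proof.
move=> f01 Xy xy; apply: inf01_le; last by exists y.
by move=> _ [z [Xz _] <-]; exact: f01.
Qed.

Lemma uop_ge i g x y : in01_on i g -> proc S i x ->
  pbar S i i.+1 x y -> g x <= uop S i g y.
Proof.
move=> g01 Xx xy; apply: sup01_ge; last by exists x.
by move=> _ [z [Xz _] <-]; exact: g01.
Qed.

(** Whatever is reachable from [x'] is reachable from the earlier [x], so the infimum at [x'] ranges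
    over a smaller set. Only boundedness of [f] enters, not monotonicity. *)
Lemma lop_homo i f x x' : (1 <= i <= n)%N -> in01_on i.+1 f ->
  ple S i x x' -> lop S i f x <= lop S i f x'.
Proof.
move=> iP f01 xx'; apply: le_inf01; first by move=> _ [z [Xz _] <-]; exact: f01.
by move=> _ [z [Xz x'z] <-]; exists z => //; split => //; exact: pbar_trans_l x'z.
Qed.

(** Dually, the set of events that reach [y] grows with [y]. *)
Lemma uop_homo i g y y' : (1 <= i.+1 <= n)%N -> in01_on i g ->
  ple S i.+1 y y' -> uop S i g y <= uop S i g y'.
Proof.
move=> iP g01 yy'; apply: le_sup01; first by move=> _ [z [Xz _] <-]; exact: g01.
by move=> _ [z [Xz zy] <-]; exists z => //; split => //; exact: pbar_trans_r yy'.
Qed.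

Lemma lop_iter_in01 m k f : (k <= m)%N -> in01_on m f ->
  in01_on (m - k) (lop_iter S m k f).
Proof.
move=> + f01; elim: k => [|k IHk] km x Xx /=; first by apply: f01; rewrite subn0 in Xx.
(* Since [k < m], the truncated subtraction is exact: [(m - k.+1).+1] is [m - k], where the inner
   iterate lives. *)
by apply: lop_in01; rewrite subnSK//; apply: IHk; exact: ltnW.
Qed.

Lemma uop_iter_in01 m k g : in01_on m g -> in01_on (m + k) (uop_iter S m k g).
Proof.
move=> g01; elim: k => [|k IHk] x Xx /=; first by apply: g01; rewrite addn0 in Xx.
exact: uop_in01.
Qed.

End TransportOperators.

Section Transport.
Variables (R : realType) (n : nat) (E : Type) (S : dsystem n E).
Variables u v : nat -> E -> R.
Hypothesis u01 : forall i, (1 <= i <= n - 1)%N ->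
  forall x, proc S i x -> 0 <= u i x <= 1.
Hypothesis v01 : forall i, (1 <= i <= n - 1)%N ->
  forall y, proc S i.+1 y -> 0 <= v i y <= 1.
Hypothesis u_order : forall i, (1 <= i <= n - 1)%N ->
  represents_order (proc S i) (ple S i) (u i).
Hypothesis v_order : forall i, (1 <= i <= n - 1)%N ->
  represents_order (proc S i.+1) (ple S i.+1) (v i).

Definition transport (j m : nat) : E -> R :=
  if (m < j)%N then uop_iter S m.+1 (j - m.+1) (v m)
  else lop_iter S m (m - j) (u m).

(** With no operator applied, the term is [v m] or [u m], which represents the order. Otherwise the
    outermost operator alone makes it increasing, so no induction on the iterate is needed. *)
Lemma transport_homo j m x y : (1 <= j <= n)%N -> (1 <= m <= n - 1)%N ->
  proc S j x -> proc S j y -> ple S j x y -> transport j m x <= transport j m y.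
Proof.
move=> jP mP Xx Xy xy; rewrite /transport; case: ltnP => [mj|jm].
  have [k jE] : exists k, j = (m.+1 + k)%N by exists (j - m.+1)%N; lia.
  rewrite jE addKn in jP Xx Xy xy *; case: k {jE} => [|k] /= in jP Xx Xy xy *.
    by move: Xx Xy xy; rewrite addn0 => Xx Xy /(v_order mP Xx Xy).
  rewrite addnS in jP Xx Xy xy.
  by apply: uop_homo => //; apply: uop_iter_in01; exact: v01.
have [k mE jE] : exists2 k, (k <= m)%N & j = (m - k)%N by exists (m - j)%N; lia.
rewrite jE subKn// in jP Xx Xy xy *; case: k mE {jE} => [|k] mE /= in jP Xx Xy xy *.
  by move: Xx Xy xy; rewrite subn0 => Xx Xy /(u_order mP Xx Xy).
apply: lop_homo => //; rewrite subnSK//.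
by apply: lop_iter_in01; [exact: ltnW | exact: u01].
Qed.

(** Passing from [j] to [j.+1] adds one outer [uop] if [m < j] and strips one outer [lop] if
    [j < m]; either way a bound is compared with a member of its set. *)
Lemma transport_pbar j m x y : (1 <= j)%N -> (1 <= m <= n - 1)%N -> m != j ->
  proc S j x -> proc S j.+1 y -> pbar S j j.+1 x y ->
  transport j m x <= transport j.+1 m y.
Proof.
move=> j1 mP mj Xx Xy xy; rewrite /transport.
have [{}mj|jm] : (m < j \/ j < m)%N by lia.
  rewrite !ifT ?subSn//=; [|lia].
  rewrite subnKC//; apply: uop_ge => //.
  by rewrite -[X in proc S X](subnKC mj); apply: uop_iter_in01; exact: v01.
rewrite !ifF; [|lia..].
have -> : (m - j = (m - j.+1).+1)%N by lia.
have mE : (m - (m - j.+1) = j.+1)%N by lia.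
have mE' : (m - (m - j.+1).+1 = j)%N by lia.
rewrite /= mE'; apply: lop_le => //.
by rewrite -[X in proc S X]mE; apply: lop_iter_in01; [lia | exact: u01].
Qed.

End Transport.

(** For the converse, totality leaves the case [r y x], where no term is larger at [y] than at [x];
    if term [i] were strictly smaller at [y], so would be the sum. *)
Lemma represents_order_sum (R : realType) (T : Type) (A : set T)
    (r : T -> T -> Prop) (I : eqType) (s : seq I) (i : I) (F : I -> T -> R) :
  total_on A r -> uniq s -> i \in s ->
  (forall j x y, j \in s -> A x -> A y -> r x y -> F j x <= F j y) ->
  represents_order A r (F i) ->
  represents_order A r (fun x => \sum_(j <- s) F j x).
Proof.
move=> rT s_uniq si F_homo Fi x y Ax Ay; split=> [xy|].
  by rewrite !big_seq; apply: ler_sum => j /F_homo; exact.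
have [//|yx] := rT _ _ Ax Ay.
rewrite !(bigD1_seq i)//= => le_sum; apply/(Fi _ _ Ax Ay).
rewrite leNgt; apply/negP => Fyx; move: le_sum; apply/negP; rewrite -ltNge.
apply: ltr_leD => //; rewrite big_seq_cond [leRHS]big_seq_cond.
by apply: ler_sum => j /andP[/F_homo h _]; exact: h.
Qed.

Theorem theorem51 (R : realType) (n : nat) (E : Type) (S : dsystem n E)
    (u v w : nat -> E -> R)
    (n_ge2 : (2 <= n)%N)
    (S_line : line_communication S)
    (S_causal_ordering : causal_ordering S)
    (S_strict : StrictOrder (causal_precedence S))
    (u01 : forall i, (1 <= i <= n - 1)%N ->
       forall x, proc S i x -> 0 < u i x < 1)
    (v01 : forall i, (1 <= i <= n - 1)%N ->
       forall y, proc S i.+1 y -> 0 < v i y < 1)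
    (uv_biorder : forall i, (1 <= i <= n - 1)%N ->
       represents_biorder (proc S i) (proc S i.+1) (pbar S i i.+1) (u i) (v i))
    (u_order : forall i, (1 <= i <= n - 1)%N ->
       represents_order (proc S i) (ple S i) (u i))
    (v_order : forall i, (1 <= i <= n - 1)%N ->
       represents_order (proc S i.+1) (ple S i.+1) (v i))
    (w_first : forall x, proc S 1 x ->
       w 1%N x = u 1%N x
         + \sum_(1 <= k < n - 1) lop_iter S (k + 1) k (u (k + 1)%N) x)
    (w_mid : forall j, (2 <= j <= n - 1)%N -> forall x, proc S j x ->
       w j x = \sum_(1 <= k < j - 1) uop_iter S (k + 1) (j - 1 - k) (v k) x
         + v (j - 1)%N x + u j x
         + \sum_(1 <= k < n - j) lop_iter S (k + j) k (u (k + j)%N) x)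
    (w_last : forall x, proc S n x ->
       w n x = v (n - 1)%N x
         + \sum_(1 <= k < n - 1) uop_iter S (n - k) k (v (n - 1 - k)%N) x) :
  weak_representation S w.
Proof.
have u01' i : (1 <= i <= n - 1)%N -> forall x, proc S i x -> 0 <= u i x <= 1.
  by move=> iP x /(u01 _ iP)/andP[/ltW-> /ltW->].
have v01' i : (1 <= i <= n - 1)%N -> forall y, proc S i.+1 y -> 0 <= v i y <= 1.
  by move=> iP x /(v01 _ iP)/andP[/ltW-> /ltW->].
pose t := transport S u v.
have tu j : t j j = u j by rewrite /t /transport ltnn subnn.
have tv j : t j.+1 j = v j by rewrite /t /transport ltnSn subnn.
have sum_u j x : (1 <= j)%N ->
    \sum_(j.+1 <= m < n) t j m x =
    \sum_(1 <= k < n - j) lop_iter S (k + j) k (u (k + j)%N) x.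
  move=> j1; rewrite -add1n big_addn; apply: eq_bigr => k _.
  by rewrite /t /transport ltnNge leq_addl /= addnK.
have sum_v j x : (2 <= j)%N ->
    \sum_(1 <= m < j) t j m x =
    \sum_(1 <= k < j - 1) uop_iter S (k + 1) (j - 1 - k) (v k) x + v (j - 1)%N x.
  case: j => [//|j] j1; rewrite subn1 big_nat_recr//= tv; congr (_ + _).
  by apply: eq_big_nat => k /andP[_ kj]; rewrite /t /transport ltnS ltnW// addn1.
(* The three formulas for [w] are one sum cut at [m = j]: the lower block is empty for [j = 1], the
   upper one for [j = n]. *)
have wE j x : (1 <= j <= n)%N -> proc S j x -> w j x = \sum_(1 <= m < n) t j m x.
  move=> jP Xx; have [j1|j1] := eqVneq j 1%N.
    by subst j; rewrite w_first// [RHS]big_ltn// tu sum_u.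
  have [jn|jn] := eqVneq j n.
    (* The formula for [w n] counts operators rather than communications, hence the reversal of [k]
       into [n - 1 - k]. *)
    subst j; rewrite w_last// sum_v// addrC big_nat_rev /=; congr (_ + _).
    by apply: eq_big_nat => k kP; congr (uop_iter _ _ _ (v _) _); lia.
  rewrite w_mid//; last by lia.
  rewrite [RHS](big_cat_nat (n := j)) /=; [|lia|lia].
  rewrite sum_v; last by lia.
  rewrite [X in _ = _ + X]big_ltn ?tu; last by lia.
  by rewrite sum_u ?addrA//; lia.
split=> [i iP|i j iP jP _ x y Xx Xy].
  have [_ _ _ _ tot] := ple_total_order S iP.
  have t_homo m x y : m \in index_iota 1 n -> proc S i x -> proc S i y ->
      ple S i x y -> t i m x <= t i m y.
    by rewrite mem_index_iota => mP; apply: transport_homo => //; lia.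
  suff [m mP tm] : exists2 m, m \in index_iota 1 n &
      represents_order (proc S i) (ple S i) (t i m).
    have := represents_order_sum tot (iota_uniq _ _) mP t_homo tm.
    by move=> h x y Xx Xy; rewrite !wE//; exact: h.
  (* The last process sends nothing onward and has no [u n]; there [v (n - 1)], the term
     [m = n - 1], represents the order. Elsewhere [u i] does. *)
  have [->|ni] := eqVneq i n.
    exists (n - 1)%N; first by rewrite mem_index_iota; lia.
    have := v_order (n - 1)%N; rewrite -tv; have -> : (n - 1).+1 = n by lia.
    by apply; lia.
  exists i; first by rewrite mem_index_iota; lia.
  by rewrite tu; apply: u_order; lia.
(* Unless [j] is [i.+1], the message inside [pbar] contradicts line communication. *)
have [ij xy|ij [a [b [_ ab _]]]] := eqVneq j i.+1; last first.
  by case: (S_line _ _ iP jP (elimN eqP ij) _ _ ab).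
subst j; rewrite !wE//.
have im : i \in index_iota 1 n by rewrite mem_index_iota; lia.
rewrite !(bigD1_seq i) ?iota_uniq//= tu tv; apply: ltr_leD.
  by apply/(uv_biorder _ _ _ _ Xx Xy) => //; lia.
rewrite big_nat_cond [leRHS]big_nat_cond; apply: ler_sum => m /andP[mP mi].
by apply: transport_pbar => //; lia.
Qed.
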